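(* Consider the multi-demand auction model with item types $N=\{1,\dots,n\}$, supply vector $u$, bidders $M=\{1,\dots,m\}$, and valuation functions $v_b:[\mathbf 0,u]_{\mathbb Z}\to\mathbb Z$ $(b\in M)$ that are monotone nondecreasing, satisfy $v_b(\mathbf 0)=0$, and are M$^\natural$-concave. Let $p^*_{\min}$ be the unique minimal (Walrasian) equilibrium price vector. Run the algorithm Ascending Auction from an initial vector $p^\circ\in\mathbb Z^n_+$ with $p^\circ\le p^*_{\min}$. If, in each iteration, the item set $X$ selected in Step 2 is such that (i) $X$ is a minimal (with respect to inclusion) overdemanded set at price $p$, or (ii) $X$ is the unique minimal (with respect to inclusion) maximizer of the deficiency $\delta(\cdot\,;p)$ over the subsets of $N$, then the algorithm finds $p^*_{\min}$; that is, it terminates and the vector $p$ at termination equals $p^*_{\min}$.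
   Context: Multi-demand model. $N=\{1,\dots,n\}$ is the set of item types, $u=(u(1),\dots,u(n))$ is a vector of positive integers ($u(i)$ is the number of supplied units of item $i$), $M=\{1,\dots,m\}$ is the set of bidders, and $[\mathbf 0,u]_{\mathbb Z}=\{x\in\mathbb Z^n\mid 0\le x(i)\le u(i)\ (i\in N)\}$. Each bidder $b\in M$ has a valuation function $v_b:[\mathbf 0,u]_{\mathbb Z}\to\mathbb Z$, monotone nondecreasing with $v_b(\mathbf 0)=0$. For $p\in\mathbb Z^n_+$ the demand set is $D_b(p)=\arg\max\{v_b(x)-p^\top x\mid x\in[\mathbf 0,u]_{\mathbb Z}\}$. An allocation is a family $x_1,\dots,x_m\in[\mathbf 0,u]_{\mathbb Z}$ with $\sum_{b=1}^m x_b=u$. A pair of a price vector $p^*\in\mathbb Z^n_+$ and an allocation $x^*_1,\dots,x^*_m$ with $x^*_b\in D_b(p^* )$ for all $b\in M$ is a (Walrasian) equilibrium, and $p^*$ is then a (Walrasian) equilibrium price vector. When all $v_b$ are M$^\natural$-concave, an equilibrium exists and there is a unique minimal equilibrium price vector (componentwise order), denoted $p^*_{\min}$. M$^\natural$-concavity. For $i\in N$, $\chi_i$ is the $i$th unit vector, and $\chi_0=\mathbf 0$. For $z\in\mathbb Z^n$, $\mathrm{supp}^+(z)=\{i\in N\mid z(i)>0\}$ and $\mathrm{supp}^-(z)=\{i\in N\mid z(i)<0\}$. A function $v:[\mathbf 0,u]_{\mathbb Z}\to\mathbb Z$ is M$^\natural$-concave if for all $x,y\in[\mathbf 0,u]_{\mathbb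 Z}$ and all $i\in\mathrm{supp}^+(x-y)$ there exists $k\in\mathrm{supp}^-(x-y)\cup\{0\}$ with $v(x)+v(y)\le v(x-\chi_i+\chi_k)+v(y+\chi_i-\chi_k)$. Overdemand and deficiency. For $y\in\mathbb Z^n$ and $X\subseteq N$, $y(X)=\sum_{i\in X}y(i)$. For $p\in\mathbb Z^n_+$ and $X\subseteq N$ let $\mu_b(X;p)=\min\{y(X)\mid y\in D_b(p)\}$ $(b\in M)$. The deficiency of $X$ at $p$ is $\delta(X;p)=\sum_{b\in M}\mu_b(X;p)-u(X)$. The set $X$ is overdemanded at $p$ if $\sum_{b\in M}\mu_b(X;p)>u(X)$. When every valuation function $v_b$ $(b\in M)$ is monotone nondecreasing with $v_b(\mathbf 0)=0$ and M$^\natural$-concave, for each $p\in\mathbb Z^n_+$ there is a unique minimal (with respect to inclusion) maximizer of $\delta(\cdot\,;p)$ over the subsets of $N$. Algorithm Ascending Auction. ($\chi_X\in\{0,1\}^n$ is the characteristic vector of $X$.) Step 0: Set $p:=p^\circ$, where $p^\circ\in\mathbb Z^n_+$ satisfies $p^\circ\le p^*_{\min}$. Step 1: If there is no overdemanded set at price $p$, then stop. Step 2: Find an item set $X\subseteq N$ that is overdemanded at price $p$. Step 3: Set $p:=p+\chi_X$ and go to Step 1. *)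

(* Defs.v *)
From HB Require Import structures.
From mathcomp Require Import all_boot all_order all_algebra.

Set Implicit Arguments.
Unset Strict Implicit.
Unset Printing Implicit Defensive.

Import Order.TTheory GRing.Theory Num.Theory.

Local Open Scope ring_scope.

(** Integer vectors *)

Notation "''Zv_' n" := {ffun 'I_n -> int}
  (at level 8, n at level 2, format "''Zv_' n") : type_scope.

Definition lev n (p q : 'Zv_n) : Prop := forall i, p i <= q i.

(* chi k is the k-th unit vector, where None plays the role of the index 0
   (chi_0 = 0). *)
Definition chi n (k : option 'I_n) : 'Zv_n := [ffun j => (k == Some j)%:R].

Definition chi_set n (X : {set 'I_n}) : 'Zv_n := [ffun j => (j \in X)%:R].

Definition suppP n (z : 'Zv_n) : {set 'I_n} := [set i | 0 < z i].
Definition suppN n (z : 'Zv_n) : {set 'I_n} := [set i | z i < 0].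

Definition dot n (p y : 'Zv_n) : int := \sum_i p i * y i.

Definition vsum n (y : 'Zv_n) (X : {set 'I_n}) : int := \sum_(i in X) y i.

(** Bundles: the integer interval [0, u] as a finite type *)

Notation box u := {dffun forall i, 'I_(u i).+1}.

Definition vec n (u : 'I_n -> nat) (x : box u) : 'Zv_n :=
  [ffun i => (x i)%:Z].

Definition supply n (u : 'I_n -> nat) : 'Zv_n := [ffun i => (u i)%:Z].

(** Valuation functions *)

Definition monotone n (u : 'I_n -> nat) (v : box u -> int) : Prop :=
  forall x y : box u, lev (vec x) (vec y) -> v x <= v y.

Definition zero_at_zero n (u : 'I_n -> nat) (v : box u -> int) : Prop :=
  forall x : box u, vec x = 0 -> v x = 0.

(* The bundles x' and y' are x - chi_i + chi_k and y + chi_i - chi_k; for i and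
   k in the stated supports both vectors do lie in [0, u]. *)
Definition Mnat_concave n (u : 'I_n -> nat) (v : box u -> int) : Prop :=
  forall (x y : box u) (i : 'I_n), i \in suppP (vec x - vec y) ->
  exists k : option 'I_n,
    (if k is Some j then j \in suppN (vec x - vec y) else true) /\
    exists x' y' : box u,
      [/\ vec x' = vec x - chi (Some i) + chi k,
          vec y' = vec y + chi (Some i) - chi k
        & v x + v y <= v x' + v y'].

Definition demand n (u : 'I_n -> nat) (v : box u -> int) (p : 'Zv_n)
    : {set box u} :=
  [set x | [forall y, v y - dot p (vec y) <= v x - dot p (vec x)]].

(** Equilibria *)

Definition allocation n (u : 'I_n -> nat) m (x : 'I_m -> box u) : Prop :=
  \sum_b vec (x b) = supply u.

Definition equilibrium n (u : 'I_n -> nat) m (v : 'I_m -> box u -> int)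
    (p : 'Zv_n) (x : 'I_m -> box u) : Prop :=
  [/\ lev 0 p, allocation x & forall b, x b \in demand (v b) p].

Definition equilibrium_price n (u : 'I_n -> nat) m
    (v : 'I_m -> box u -> int) (p : 'Zv_n) : Prop :=
  exists x, equilibrium v p x.

Definition minimal_equilibrium_price n (u : 'I_n -> nat) m
    (v : 'I_m -> box u -> int) (p : 'Zv_n) : Prop :=
  equilibrium_price v p /\
  forall q, equilibrium_price v q -> lev q p -> q = p.

(** Overdemand and deficiency *)

(* The base value u(X) is an upper bound of y(X) on the whole box, so that this
   is the minimum over the (nonempty) demand set; see mu_min below. *)
Definition mu n (u : 'I_n -> nat) (v : box u -> int) (p : 'Zv_n)
    (X : {set 'I_n}) : int :=
  \big[Num.min/vsum (supply u) X]_(y in demand v p) vsum (vec y) X.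

Definition deficiency n (u : 'I_n -> nat) m (v : 'I_m -> box u -> int)
    (p : 'Zv_n) (X : {set 'I_n}) : int :=
  \sum_b mu (v b) p X - vsum (supply u) X.

Definition overdemanded n (u : 'I_n -> nat) m (v : 'I_m -> box u -> int)
    (p : 'Zv_n) (X : {set 'I_n}) : bool :=
  vsum (supply u) X < \sum_b mu (v b) p X.

Definition deficiency_maximizer n (u : 'I_n -> nat) m
    (v : 'I_m -> box u -> int) (p : 'Zv_n) (X : {set 'I_n}) : bool :=
  [forall Y, deficiency v p Y <= deficiency v p X].

(** Executions of the ascending auction *)

Definition stopped n (u : 'I_n -> nat) m (v : 'I_m -> box u -> int)
    (p : 'Zv_n) : bool :=
  ~~ [exists X, overdemanded v p X].

(* P t and X t are the price and the selected set in iteration t.  An execution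
   that has stopped is continued by repeating its last price; X t is then
   irrelevant. *)
Definition ascending_auction_run n (u : 'I_n -> nat) m
    (v : 'I_m -> box u -> int) (p0 : 'Zv_n)
    (P : nat -> 'Zv_n) (X : nat -> {set 'I_n}) : Prop :=
  P 0%N = p0 /\
  forall t, if stopped v (P t) then P t.+1 = P t
            else overdemanded v (P t) (X t) /\ P t.+1 = P t + chi_set (X t).

Lemma demand_nonempty n (u : 'I_n -> nat) (v : box u -> int) (p : 'Zv_n) :
  exists x, x \in demand v p.
Proof.
pose z : box u := [ffun i => ord0].
case: (@arg_maxP _ _ _ z predT (fun x => v x - dot p (vec x)) isT) => x _ xmax.
by exists x; rewrite inE; apply/forallP => y; apply: xmax.
Qed.

Lemma mu_min n (u : 'I_n -> nat) (v : box u -> int) (p : 'Zv_n)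
    (X : {set 'I_n}) :
  (exists2 y, y \in demand v p & mu v p X = vsum (vec y) X) /\
  (forall y, y \in demand v p -> mu v p X <= vsum (vec y) X).
Proof.
have lb y : y \in demand v p -> mu v p X <= vsum (vec y) X.
  by move=> yD; rewrite /mu; apply: bigmin_le_cond.
split=> //; have [x0 x0D] := demand_nonempty v p.
case: (arg_minP (fun y => vsum (vec y) X) x0D) => y yD ymin.
exists y => //; apply/le_anti/andP; split; first exact: lb.
apply: le_bigmin => //; apply: ler_sum => i _.
by rewrite !ffunE lez_nat -ltnS ltn_ord.
Qed.

(* Main.v *)
Require Import Defs.
From mathcomp Require Import all_boot all_order all_algebra.
From mathcomp Require Import zify ring.
Set Implicit Arguments.
Unset Strict Implicit.
Unset Printing Implicit Defensive.
Import Order.TTheory GRing.Theory Num.Theory.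
Local Open Scope ring_scope.

(** For a bidder with valuation v let V(p) be the indirect utility, the
maximum of v(x) - p.x.  The theorem follows from two consequences of
M-natural-concavity, both drawn from one exchange step ([demand_exchange]):
a bundle z holding less of X than any bundle in the demand at q can be
improved at q so that it gains exactly one unit of X and loses at most one unit
of the items outside X.

- [indirect_step]: V(p + chi_X) = V(p) - mu(X; p).  Since -mu(X; p) is
  the slope of V at p towards chi_X, this says that V stays affine up to the
  next integer price, thanks to the exchange step and the integrality of v.
- [mu_antitone]: if, from p to q, all prices in X rise by the same c >= 0 and
  no other price rises by more than c, then mu(X; q) <= mu(X; p).  This is
  the gross substitutes effect for c = 0 and the descent inequality of
  L-natural-convexity for c > 0.

The price never overshoots an equilibrium price q.  Let p <= q, let Z be the
items of X whose price is already equal to q, and let W be the rest of X.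
Raising W first, mu(X; p) - mu(W; p) = mu(Z; p + chi_W), which is at most
mu(Z; q) because only prices outside Z rise further on the way to q.  Summed
over the bidders, dropping Z from X lowers the deficiency by at most the
deficiency of Z at q, which is not positive ([deficiency_drop_tight]).  A
minimal overdemanded set or a minimal maximizer of the deficiency therefore has
Z empty, and p + chi_X <= q.

A price p <= q without overdemanded set is an equilibrium price.  Let
L(p) = sum_b V_b(p) + p.u, so that L(p + chi_X) = L(p) - delta(X; p).  Going
down from q to p by always lowering the items with the largest excess over p,
each step satisfies the hypotheses of [mu_antitone] relative to p, so the
deficiency of the lowered set is at most its deficiency at p, which is not
positive, and L does not increase.  Hence L(p) <= L(q).  The value of the
allocation that supports q bounds L from below and equals L(q); at p the bound
is thus tight too, which says that every bidder demands at p the bundle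
allotted at q ([stopped_equilibrium]).

Overdemanded sets are nonempty, so the price strictly increases below the
minimal equilibrium price until the auction stops, and minimality identifies
the last price. *)

(** * Integer vectors *)

Section Vectors.
Variable n : nat.
Implicit Types (p q y z : 'Zv_n) (X Y : {set 'I_n}).

Lemma dotDl p q y : dot (p + q) y = dot p y + dot q y.
Proof.
by rewrite -big_split /=; apply: eq_bigr => i _; rewrite ffunE mulrDl.
Qed.

Lemma dotBl p q y : dot (p - q) y = dot p y - dot q y.
Proof. by rewrite -sumrB; apply: eq_bigr => i _; rewrite !ffunE mulrBl. Qed.

Lemma dotDr p y z : dot p (y + z) = dot p y + dot p z.
Proof.
by rewrite -big_split /=; apply: eq_bigr => i _; rewrite ffunE mulrDr.
Qed.

Lemma dotBr p y z : dot p (y - z) = dot p y - dot p z.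
Proof. by rewrite -sumrB; apply: eq_bigr => i _; rewrite !ffunE mulrBr. Qed.

Lemma dot_sumr (I : finType) p (f : I -> 'Zv_n) :
  dot p (\sum_b f b) = \sum_b dot p (f b).
Proof.
by rewrite exchange_big; apply: eq_bigr => i _; rewrite sum_ffunE mulr_sumr.
Qed.

Lemma dot_chi_set X y : dot (chi_set X) y = vsum y X.
Proof.
rewrite /dot /vsum [RHS]big_mkcond; apply: eq_bigr => i _; rewrite ffunE.
by case: (i \in X); rewrite ?mul1r ?mul0r.
Qed.

Lemma vsumD y z X : vsum (y + z) X = vsum y X + vsum z X.
Proof. by rewrite -big_split /=; apply: eq_bigr => i _; rewrite ffunE. Qed.

Lemma vsumB y z X : vsum (y - z) X = vsum y X - vsum z X.
Proof. by rewrite -sumrB; apply: eq_bigr => i _; rewrite !ffunE. Qed.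

Lemma vsum_sum (I : finType) (f : I -> 'Zv_n) X :
  vsum (\sum_b f b) X = \sum_b vsum (f b) X.
Proof. by rewrite exchange_big; apply: eq_bigr => i _; rewrite sum_ffunE. Qed.

Lemma vsum_chi k X :
  vsum (chi k) X = if k is Some j then (j \in X)%:R else 0.
Proof.
case: k => [j|]; last by rewrite /vsum big1 // => i _; rewrite ffunE.
rewrite -dot_chi_set /dot (bigD1 j) //= big1 => [|i neq_ij].
  by rewrite !ffunE eqxx mulr1 addr0.
by rewrite !ffunE (inj_eq Some_inj) eq_sym (negPf neq_ij) mulr0.
Qed.

Lemma chi_set_disjointU X Y :
  [disjoint X & Y] -> chi_set (X :|: Y) = chi_set X + chi_set Y.
Proof.
move=> dXY; apply/ffunP => i; rewrite !ffunE inE.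
have := disjointFr dXY (x := i).
by case: (i \in X) => [-> //|_] /=; rewrite ?addr0 ?add0r.
Qed.

End Vectors.

Section Bidder.
Variables (n : nat) (u : 'I_n -> nat) (v : box u -> int).
Implicit Types (p q : 'Zv_n) (x y z : box u) (X Y : {set 'I_n}).

Definition util p x : int := v x - dot p (vec x).

Definition indirect p : int := util p (xchoose (demand_nonempty v p)).

Lemma util_le_indirect p x : util p x <= indirect p.
Proof.
by move: (xchooseP (demand_nonempty v p)); rewrite inE => /forallP /(_ x).
Qed.

Lemma demandE p x : (x \in demand v p) = (util p x == indirect p).
Proof.
rewrite inE; apply/forallP/eqP => [xmax|xV y].
  by apply/le_anti; rewrite util_le_indirect xmax.
by rewrite -/(util p x) xV; apply: util_le_indirect.
Qed.

(** * Exchange between two bundles *)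

Hypothesis v_Mnat : Mnat_concave v.

Lemma exchange_closer y z z' i k :
  vec z i < vec y i ->
  (forall j, k = Some j -> vec y j < vec z j) ->
  vec z' = vec z + chi (Some i) - chi k ->
  (\sum_j (y j - z' j) < \sum_j (y j - z j))%N.
Proof.
move=> lt_zy kE Ez'.
have z'E j : (z' j : nat)%:Z =
    (z j : nat)%:Z + (Some i == Some j)%:R - (k == Some j)%:R.
  by move/ffunP/(_ j): Ez'; rewrite !ffunE.
rewrite [X in (_ < X)%N](bigD1 i) //= (bigD1 i) //= -addSn leq_add //.
  have := z'E i; move: lt_zy; rewrite !ffunE eqxx.
  by case: eqP => [/kE|_] /=; rewrite ?ffunE; lia.
apply: leq_sum => j neq_ji; have := z'E j.
rewrite (inj_eq Some_inj) eq_sym (negPf neq_ji) /=.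
by case: eqP => [/kE|_] /=; rewrite ?ffunE; lia.
Qed.

(** Exchange a unit of some i in X between y and z, against the unit k given by
M-natural-concavity.  If k lies in X, both bundles keep their amount of X; y
being optimal, z does not get worse, and it moves closer to y, so this can
happen only finitely often.  Otherwise the new y has less of X than every
bundle demanded at q, so it is no longer optimal, and by integrality z gains. *)
Lemma demand_exchange q X y z :
  y \in demand v q -> vsum (vec y) X = mu v q X ->
  vsum (vec z) X < vsum (vec y) X ->
  exists z' k, [/\ if k is Some j then j \notin X else true,
    vsum (vec z') X = vsum (vec z) X + 1,
    forall j, j \notin X -> vec z' j = vec z j - chi k j
    & util q z < util q z'].
Proof.
move=> yD yX; have [d] := ubnP (\sum_j (y j - z j))%N.
elim: d z => // d IHd z ltd zX.
have [i iX lt_zy] : exists2 i, i \in X & vec z i < vec y i.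
  apply/exists_inP; rewrite -[X in is_true X]negbK; apply/negP.
  move=> /exists_inPn le_yz; move: zX; rewrite ltNge => /negP; apply.
  by apply: ler_sum => i /le_yz; rewrite -leNgt.
have iS : i \in suppP (vec y - vec z).
  by rewrite inE !ffunE; move: lt_zy; rewrite !ffunE; lia.
have [k [kS [y' [z' [Ey' Ez' le_v]]]]] := v_Mnat iS.
have le_u : util q y + util q z <= util q y' + util q z'.
  by rewrite /util Ey' Ez' dotDr !dotBr dotDr; lia.
have le_y' : util q y' <= util q y.
  by move: yD; rewrite demandE => /eqP ->; apply: util_le_indirect.
pose kX := if k is Some j then j \in X else false.
have chiX : vsum (chi k) X = kX%:R by rewrite vsum_chi /kX; case: (k).
have vs_y' : vsum (vec y') X = vsum (vec y) X - 1 + kX%:R.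
  by rewrite Ey' vsumD vsumB chiX vsum_chi iX.
have vs_z' : vsum (vec z') X = vsum (vec z) X + 1 - kX%:R.
  by rewrite Ez' vsumB vsumD chiX vsum_chi iX.
have offX j : j \notin X -> vec z' j = vec z j - chi k j.
  move=> jX; rewrite Ez' !ffunE (inj_eq Some_inj).
  by case: eqP jX => [<-|_ _]; rewrite ?iX //= addr0.
case kXE: kX vs_y' vs_z' => /= vs_y' vs_z'; last first.
  exists z', k; split=> //; last first.
  - suff : util q y' < util q y by lia.
    rewrite lt_neqAle le_y' andbT; apply/eqP => Eu.
    have y'D : y' \in demand v q by rewrite demandE Eu -demandE.
    by have := (mu_min v q X).2 _ y'D; rewrite vs_y' -yX; lia.
  - by rewrite vs_z' subr0.
  - by move: kXE; rewrite /kX; case: (k) => // j ->.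
have vs_z'z : vsum (vec z') X = vsum (vec z) X by rewrite vs_z' addrK.
have kE j : k = Some j -> vec y j < vec z j.
  by move=> Ek; move: kS; rewrite Ek inE !ffunE; lia.
have closer := exchange_closer lt_zy kE Ez'.
have [||z2 [k2 [k2X z2X off2 lt2]]] := IHd z'.
- exact: leq_trans closer ltd.
- by rewrite vs_z'z.
exists z2, k2; split=> //; first by rewrite z2X vs_z'z.
  move=> j jX; rewrite off2 // offX //; congr (_ - _).
  rewrite [chi k j]ffunE; case: eqP => [Ek|_]; last by rewrite subr0.
  by move: kXE; rewrite /kX Ek (negPf jX).
by apply: le_lt_trans lt2; lia.
Qed.

(** * The indirect utility *)

(** A bundle demanded at p with the least amount of X stays optimal at
p + chi_X.  Otherwise an optimal z at p + chi_X has less of X; one exchange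
adds a unit of X, which costs 1, and gains at least 1 by integrality, so it
leads to an optimal bundle with more of X than z. *)
Lemma indirect_step p X : indirect (p + chi_set X) = indirect p - mu v p X.
Proof.
have utilD z : util (p + chi_set X) z = util p z - vsum (vec z) X.
  by rewrite /util dotDl dot_chi_set opprD addrA.
have [[y yD yX] _] := mu_min v p X.
have yV : util p y = indirect p by apply/eqP; rewrite -demandE.
apply/le_anti/andP; split; last by rewrite yX -yV -utilD util_le_indirect.
have [z0 z0D] := demand_nonempty v (p + chi_set X).
(* Among the optimal bundles at p + chi_X, one with the most of X. *)
have [z zD zmax] := arg_maxP (fun z => vsum (vec z) X) z0D.
have zV : util (p + chi_set X) z = indirect (p + chi_set X).
  by apply/eqP; rewrite -demandE.
have [le_yz|lt_zy] := leP (vsum (vec y) X) (vsum (vec z) X).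
  by rewrite -zV utilD; have := util_le_indirect p z; lia.
have [z' [k [_ z'X _ lt_u]]] := demand_exchange yD (esym yX) lt_zy.
have le_z' := util_le_indirect (p + chi_set X) z'.
have z'D : z' \in demand v (p + chi_set X).
  by rewrite demandE eq_le le_z' -zV !utilD z'X; lia.
by have := zmax z' z'D; rewrite z'X; lia.
Qed.

(** If the demand at p contained a bundle z with less of X than every bundle
demanded at q, the exchange at q would improve z there; it would improve z at p
as well, because the unit gained in X is cheaper by c at p, while the unit
given up, if any, is cheaper by at most c. *)
Lemma mu_antitone p q X (c : int) :
  0 <= c -> (forall i, i \in X -> q i - p i = c) ->
  (forall i, i \notin X -> q i - p i <= c) -> mu v q X <= mu v p X.
Proof.
move=> c_ge0 onX offX; have [[y yD yX] _] := mu_min v q X.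
have [[z zD zX] _] := mu_min v p X; rewrite leNgt; apply/negP => lt_mu.
have [|z' [k [kX z'X z'off lt_u]]] := demand_exchange yD (esym yX) (z := z).
  by rewrite -zX -yX.
have := util_le_indirect p z'; move: zD; rewrite demandE => /eqP <-.
apply/negP; rewrite -ltNge.
suff : 0 <= dot (q - p) (vec z' - vec z).
  by move: lt_u; rewrite /util dotBr !dotBl; lia.
(* Split the change of bundle into the unit gained in X and the unit lost
   outside. *)
have -> : dot (q - p) (vec z' - vec z) =
    c * vsum (vec z' - vec z) X - \sum_(j | j \notin X) (q j - p j) * chi k j.
  rewrite /dot (bigID (mem X)) /=; congr (_ + _).
    by rewrite mulr_sumr; apply: eq_bigr => i iX; rewrite -(onX i iX) !ffunE.
  rewrite -sumrN; apply: eq_bigr => i iX.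
  by have := z'off i iX; rewrite !ffunE => ->; ring.
rewrite vsumB z'X addrAC subrr add0r mulr1 subr_ge0.
case: k kX {z'off} => [j jX|_]; last first.
  by rewrite big1 // => j _; rewrite ffunE mulr0.
rewrite (bigD1 j) //= big1 => [|i /andP[_ neq_ij]].
  by rewrite ffunE eqxx mulr1 addr0 offX.
by rewrite ffunE (inj_eq Some_inj) eq_sym (negPf neq_ij) mulr0.
Qed.

End Bidder.

(** * Deficiency, overdemand and equilibrium *)

Section Market.
Variables (n : nat) (u : 'I_n -> nat) (m : nat) (v : 'I_m -> box u -> int).
Hypothesis v_Mnat : forall b, Mnat_concave (v b).
Implicit Types (p q : 'Zv_n) (X Y : {set 'I_n}).

Lemma overdemandedE p X : overdemanded v p X = (0 < deficiency v p X).
Proof. by rewrite subr_gt0. Qed.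

Lemma equilibrium_not_overdemanded q X :
  equilibrium_price v q -> ~~ overdemanded v q X.
Proof.
case=> x [_ alloc xD]; rewrite -leNgt -alloc vsum_sum.
by apply: ler_sum => b _; apply: (mu_min _ _ _).2.
Qed.

(** Items whose price has already reached an equilibrium price cannot make a
set more deficient: their extra contribution is bounded by their deficiency at
that equilibrium price. *)
Lemma deficiency_drop_tight p q X :
  lev p q -> equilibrium_price v q ->
  deficiency v p X <= deficiency v p (X :\: [set i | p i == q i]).
Proof.
move=> le_pq eq_q; set W := X :\: _; pose Z := X :&: [set i | p i == q i].
have XE : X = W :|: Z by rewrite setUC setID.
have dWZ : [disjoint W & Z].
  rewrite -setI_eq0; apply/eqP/setP => i; rewrite !inE.
  by case: (p i == q i); rewrite ?andbF.
have muX b : mu (v b) p X <= mu (v b) p W + mu (v b) q Z.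
  (* Evaluate V(p + chi_X) in one step and in two steps. *)
  have -> : mu (v b) p X = mu (v b) p W + mu (v b) (p + chi_set W) Z.
    have := indirect_step (v_Mnat b) p X.
    rewrite {1}XE chi_set_disjointU // addrA !indirect_step //.
    by rewrite -addrA -opprD => /addrI/oppr_inj <-.
  rewrite lerD2l; apply: (mu_antitone (v_Mnat b) (lexx 0)) => i.
    by rewrite !inE => /andP[_ pq]; rewrite !ffunE !inE pq (eqP pq) addr0 subrr.
  rewrite !inE !ffunE !inE; have := le_pq i.
  by case: eqP; case: (i \in X) => //= *; lia.
have vsX : vsum (supply u) X = vsum (supply u) W + vsum (supply u) Z.
  by rewrite -!dot_chi_set -dotDl -chi_set_disjointU // -XE.
have := equilibrium_not_overdemanded Z eq_q; rewrite -leNgt => le_Z.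
rewrite /deficiency vsX opprD addrCA [leRHS]addrC lerD2l lerBlDr.
apply: (@le_trans _ _ (\sum_b (mu (v b) p W + mu (v b) q Z))).
  by apply: ler_sum => b _.
by rewrite big_split lerD2l.
Qed.

(** Without the items that have reached q, the set is still overdemanded,
respectively still a maximizer; minimality then says that it has no such
item. *)
Lemma selected_le p q X :
  lev p q -> equilibrium_price v q -> overdemanded v p X ->
  minset (overdemanded v p) X \/ minset (deficiency_maximizer v p) X ->
  lev (p + chi_set X) q.
Proof.
move=> le_pq eq_q odX selX.
have le_def := deficiency_drop_tight X le_pq eq_q.
have EX : X :\: [set i | p i == q i] = X.
  case: selX => /minsetP[PX minX]; apply: minX; rewrite ?subsetDl //.
    by rewrite overdemandedE (lt_le_trans _ le_def) // -overdemandedE.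
  by apply/forallP => Y; apply: le_trans le_def; move/forallP: PX; apply.
move=> i; rewrite !ffunE; have := le_pq i.
case iX: (i \in X); last by rewrite addr0.
by move: iX; rewrite -EX !inE => /andP[/eqP + _] /=; lia.
Qed.

(** Its minimizers over the nonnegative prices are the equilibrium prices, when
there are any. *)
Definition lyapunov p : int := \sum_b indirect (v b) p + dot p (supply u).

Lemma lyapunov_step p X :
  lyapunov (p + chi_set X) = lyapunov p - deficiency v p X.
Proof.
rewrite /lyapunov /deficiency dotDl dot_chi_set.
under eq_bigr do rewrite indirect_step //.
rewrite sumrB; ring.
Qed.

(** Local optimality in the directions chi_X implies optimality among all
higher prices, as for any L-natural-convex function: descend from q to p by
lowering the items with the largest excess over p. *)
Lemma stopped_lyapunov_le p q :
  stopped v p -> lev p q -> lyapunov p <= lyapunov q.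
Proof.
move=> stop_p; have [d] := ubnP (\sum_i `|q i - p i|)%N.
elim: d q => // d IHd q ltd le_pq.
have [->//|neq_pq] := eqVneq p q.
have [i0 neq0] : exists i, p i != q i.
  apply/existsP; apply: contraNT neq_pq => /existsPn eq_pq.
  by apply/eqP/ffunP => i; apply/eqP; move: (eq_pq i); rewrite negbK.
have [a _ amax] := @arg_maxP _ _ _ i0 predT (fun i => q i - p i) isT.
have a_gt0 : 0 < q a - p a.
  by have := amax i0 isT; have := le_pq i0; move: neq0 => /=; lia.
pose X := [set i | q i - p i == q a - p a].
pose q' := q - chi_set X.
have q'E i : q' i = q i - (q i - p i == q a - p a)%:R by rewrite !ffunE inE.
have -> : q = q' + chi_set X by rewrite subrK.
have le_pq' : lev p q'.
  by move=> i; rewrite q'E; have := le_pq i; case: eqP => /=; lia.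
apply: (@le_trans _ _ (lyapunov q')).
  apply: (IHd _ _ le_pq'); apply: leq_trans _ (ltd : (_ <= d)%N).
  rewrite [X in (_ < X)%N](bigD1 a) //= (bigD1 a) //= -addSn leq_add //.
    by rewrite q'E eqxx; lia.
  by apply: leq_sum => i _; have := le_pq' i; have := le_pq i; rewrite q'E; lia.
rewrite lyapunov_step lerDl oppr_ge0.
apply: (@le_trans _ _ (deficiency v p X)); last first.
  by move/existsPn: stop_p => /(_ X); rewrite overdemandedE -leNgt.
rewrite lerD2r; apply: ler_sum => b _.
apply: (mu_antitone (v_Mnat b) (c := q a - p a - 1)) => [|i|i]; first by lia.
  by rewrite inE q'E => /[dup] /eqP E ->; rewrite /=; lia.
by rewrite inE q'E; have := amax i isT; case: eqP => /=; lia.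
Qed.

(** The value of the allocation supporting q equals L(q) and is a lower bound
of L(p), where the gap is the sum over the bidders of the loss from receiving
the allotted bundle at price p. *)
Lemma stopped_equilibrium p q :
  lev 0 p -> lev p q -> stopped v p -> equilibrium_price v q ->
  equilibrium_price v p.
Proof.
move=> p_ge0 le_pq stop_p [x [_ alloc xD]]; exists x; split=> // b0.
have lyapE r : lyapunov r - \sum_b v b (x b) =
    \sum_b (indirect (v b) r - util (v b) r (x b)).
  rewrite /lyapunov -alloc dot_sumr /util !sumrB; ring.
have le0 : \sum_b (indirect (v b) p - util (v b) p (x b)) <= 0.
  rewrite -lyapE; have := stopped_lyapunov_le stop_p le_pq.
  rewrite -(lerD2r (- \sum_b v b (x b))) [leRHS]lyapE => /le_trans; apply.
  rewrite big1 // => b _; have := xD b.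
  by rewrite demandE => /eqP ->; rewrite subrr.
have ge0 b : 0 <= indirect (v b) p - util (v b) p (x b).
  by rewrite subr_ge0 util_le_indirect.
have sum0 : \sum_b (indirect (v b) p - util (v b) p (x b)) = 0.
  by apply/le_anti; rewrite le0 sumr_ge0.
by rewrite demandE eq_sym -subr_eq0; apply/eqP; apply: (psumr_eq0P _ sum0).
Qed.

Lemma overdemanded_neq0 p X : overdemanded v p X -> X != set0.
Proof.
apply: contraTneq => ->; rewrite -leNgt [leRHS]big_set0.
apply: sumr_le0 => b _; have [[y _ ->] _] := mu_min (v b) p set0.
by rewrite [leLHS]big_set0.
Qed.

End Market.

Theorem theorem3p2 (n : nat) (u : 'I_n -> nat) (u_gt0 : forall i, (0 < u i)%N)
    (m : nat) (v : 'I_m -> box u -> int)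
    (v_mono : forall b, monotone (v b))
    (v_zero : forall b, zero_at_zero (v b))
    (v_Mnat : forall b, Mnat_concave (v b))
    (pmin : 'Zv_n) (pmin_minimal : minimal_equilibrium_price v pmin)
    (p0 : 'Zv_n) (p0_ge0 : lev 0 p0) (p0_le : lev p0 pmin)
    (P : nat -> 'Zv_n) (X : nat -> {set 'I_n})
    (run : ascending_auction_run v p0 P X)
    (selection : forall t, ~~ stopped v (P t) ->
       minset (overdemanded v (P t)) (X t) \/
       minset (deficiency_maximizer v (P t)) (X t)) :
  exists T : nat, stopped v (P T) /\ P T = pmin.
Proof.
have [eq_min minimal] := pmin_minimal; have [P0 step] := run.
have bounds t : lev 0 (P t) /\ lev (P t) pmin.
  elim: t => [|t [ge0 le_min]]; first by rewrite P0.
  have := step t; have := selection t.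
  case: ifP => [_ _ ->//|_ /(_ isT) sel [od ->]].
  split; last exact: selected_le sel.
  move=> i; rewrite !ffunE; have := ge0 i; rewrite !ffunE.
  by case: (i \in X t) => /=; lia.
suff [T stopT] : exists T, stopped v (P T).
  exists T; split=> //; have [ge0 le_min] := bounds T.
  exact: minimal (stopped_equilibrium v_Mnat ge0 le_min stopT eq_min) le_min.
pose gap t := (\sum_i `|pmin i - P t i|)%N.
have [d] := ubnP (gap 0%N); elim: d 0%N => // d IHd t ltd.
have [|running] := boolP (stopped v (P t)); first by exists t.
apply: (IHd t.+1); apply: leq_trans _ (ltd : (_ <= d)%N).
have := step t; rewrite (negPf running) => -[od Pt1].
have /set0Pn[i iX] := overdemanded_neq0 od.
have shrink j : pmin j - P t.+1 j = pmin j - P t j - (j \in X t)%:R.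
  by rewrite Pt1 !ffunE opprD addrA.
rewrite /gap [X in (_ < X)%N](bigD1 i) //= (bigD1 i) //= -addSn leq_add //.
  by have := (bounds t.+1).2 i; have := shrink i; rewrite iX /=; lia.
apply: leq_sum => j _.
by have := (bounds t.+1).2 j; have := shrink j; case: (j \in X t) => /=; lia.
Qed.
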